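(* Let $\operatorname{T}:\mathbb{R}^d\to\mathbb{R}^d$ and $\mathbf{x}^\star\in\operatorname{Fix}\operatorname{T}$. Let $\{\mathbf{x}(k)\}_{k\in\mathbb{N}_0}$ be generated by DEGAS (recursion given in the context), where the delay sequence $\{\tau(k)\}_{k\in\mathbb{N}_0}$ and the block sequence $\{i(k)\}_{k\in\mathbb{N}_0}$ are independent, and suppose that there is $\bar\tau\in\mathbb{N}_0$ such that $\tau(k)\le\bar\tau$ for all $k\in\mathbb{N}_0$. If $\operatorname{T}$ is an averaged operator, then $$\min_{t\le k}\mathbb{E}\big[\|(\operatorname{Id}-\operatorname{T})(\mathbf{x}(t))\|^2\big]=O(1/k).$$ If $\operatorname{T}$ is also pseudo-contractive with modulus $c\in(0,1)$, then for all $k\in\mathbb{N}_0$ $$\mathbb{E}[\|\mathbf{x}(k)-\mathbf{x}^\star\|^2]\le\rho_a^k\,\|\mathbf{x}(0)-\mathbf{x}^\star\|^2,\qquad \rho_a=\Big(1-\frac{1-c^2}{m}\Big)^{\frac{1}{1+\bar\tau/m}}.$$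
   Context: $\mathbb{N}=\{1,2,\dots\}$, $\mathbb{N}_0=\mathbb{N}\cup\{0\}$, $[m]=\{1,\dots,m\}$, $\|\cdot\|$ is the Euclidean norm, $\operatorname{Id}$ is the identity and $\operatorname{Fix}\operatorname{T}=\{\mathbf{x}:\operatorname{T}(\mathbf{x})=\mathbf{x}\}$. Vectors $\mathbf{x}\in\mathbb{R}^d$ are split into $m\in\mathbb{N}$ blocks, $\mathbf{x}=(x_1,\dots,x_m)$, $x_i\in\mathbb{R}^{d_i}$, $\sum_i d_i=d$, and $\operatorname{T}(\mathbf{x})=(\operatorname{T}_1(\mathbf{x}),\dots,\operatorname{T}_m(\mathbf{x}))$ is split accordingly. DEGAS: from a deterministic initial iterate $\mathbf{x}(0)\in\mathbb{R}^d$, for each $k\in\mathbb{N}_0$, $$x_j(k+1)=\operatorname{T}_j(\mathbf{x}(k-\tau(k)))\ \text{ if } j=i(k),\qquad x_j(k+1)=x_j(k)\ \text{ otherwise},$$ where the delay $\tau(k)$ is an integer in $[0,k]$, and the selected blocks $i(k)$ are independent and each uniformly distributed on $[m]$. The expectation is taken over the block selections only (the delay sequence, being independent of the blocks, is treated as fixed). $\operatorname{T}$ is $\alpha$-averaged if $\operatorname{T}=(1-\alpha)\operatorname{Id}+\alpha R$ for some $\alpha\in(0,1)$ and some non-expansive operator $R$ (i.e. $\|R(\mathbf{x})-R(\mathbf{y})\|\le\|\mathbf{x}-\mathbf{y}\|$ for all $\mathbf{x},\mathbf{y}$); it is averaged if it is $\alpha$-averaged for some $\alpha\in(0,1)$.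 $\operatorname{T}$ is pseudo-contractive with modulus $c\in(0,1)$ if $\operatorname{Fix}\operatorname{T}\neq\emptyset$ and $\|\operatorname{T}(\mathbf{x})-\operatorname{T}(\mathbf{x}^\star)\|\le c\|\mathbf{x}-\mathbf{x}^\star\|$ for all $\mathbf{x}^\star\in\operatorname{Fix}\operatorname{T}$ and $\mathbf{x}\in\mathbb{R}^d$. *)

(* Defs.v *)
From mathcomp Require Import all_boot all_order all_algebra.
From mathcomp Require Import finmap.
From mathcomp Require Import all_classical all_reals all_analysis.

Set Implicit Arguments.
Unset Strict Implicit.
Unset Printing Implicit Defensive.

Import Order.TTheory GRing.Theory Num.Theory.

Local Open Scope classical_set_scope.
Local Open Scope ring_scope.

(* The library norm on matrices is the sup norm. *)
Definition eucl_norm (R : realType) (n : nat) (x : 'rV[R]_n) : R :=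
  Num.sqrt (\sum_(l < n) x ord0 l ^+ 2).

Section Operators.
Variables (R : realType) (n : nat).
Implicit Type T : 'rV[R]_n -> 'rV[R]_n.

Definition Fix T : set 'rV[R]_n := [set x | T x = x].

Definition nonexpansive T : Prop :=
  forall x y, eucl_norm (T x - T y) <= eucl_norm (x - y).

Definition alpha_averaged (alpha : R) T : Prop :=
  0 < alpha < 1 /\
  exists2 N : 'rV[R]_n -> 'rV[R]_n,
    nonexpansive N & forall x, T x = (1 - alpha) *: x + alpha *: N x.

Definition averaged T : Prop := exists alpha : R, alpha_averaged alpha T.

Definition pseudo_contractive (c : R) T : Prop :=
  [/\ 0 < c < 1, Fix T !=set0 &
      forall xs x, Fix T xs ->
        eucl_norm (T x - T xs) <= c * eucl_norm (x - xs)].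

End Operators.

(* The finite set 'I_m carries the discrete sigma-algebra; it is not declared
   as a measurableType, which would require a distinguished point of 'I_m. *)
Section BlockSelection.
Context d (Omega : measurableType d) (R : realType).
Variables (P : probability Omega R) (m : nat).

Definition block_rv (X : Omega -> 'I_m) : Prop :=
  forall A : set 'I_m, measurable (X @^-1` A).

Definition mutually_independent (X : nat -> Omega -> 'I_m) : Prop :=
  forall (J : {fset nat}) (A : nat -> set 'I_m),
    P (\bigcap_(k in [set` J]) (X k @^-1` A k)) =
    (\prod_(k <- J) P (X k @^-1` A k))%E.

Definition uniform_block (X : Omega -> 'I_m) : Prop :=
  forall j : 'I_m, P (X @^-1` [set j]) = (m%:R^-1)%:E.

End BlockSelection.

(* R^d is 'rV_(\sum_j d_ j), and submxrow x j is the block x_j in R^(d_j).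
   The recursion holds for every outcome w; since tau k <= k, the natural
   subtraction k - tau k is exact. *)
Definition degas (Omega : Type) (R : realType) (m : nat) (d_ : 'I_m -> nat)
    (T : 'rV[R]_(\sum_j d_ j) -> 'rV[R]_(\sum_j d_ j))
    (tau : nat -> nat) (i : nat -> Omega -> 'I_m)
    (x0 : 'rV[R]_(\sum_j d_ j))
    (x : nat -> Omega -> 'rV[R]_(\sum_j d_ j)) : Prop :=
  [/\ forall k, (tau k <= k)%N,
      forall w, x 0%N w = x0 &
      forall k w (j : 'I_m),
        submxrow (x k.+1 w) j =
          if j == i k w then submxrow (T (x (k - tau k)%N w)) j
          else submxrow (x k w) j].

(* Main.v *)
Require Import Defs.
From mathcomp Require Import all_boot all_order all_algebra.
From mathcomp Require Import finmap.
From mathcomp Require Import all_classical all_reals all_analysis.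
From mathcomp Require Import ring lra.

Set Implicit Arguments.
Unset Strict Implicit.
Unset Printing Implicit Defensive.

Import Order.TTheory GRing.Theory Num.Theory.

Local Open Scope classical_set_scope.
Local Open Scope ring_scope.

(** Write V k for the mean of |x k - z|^2, where z is a fixed point of T.  The
block i k is independent of the past, on which x k and x (k - tau k) depend,
and it is uniform.  Since exactly one block moves, and since squared norms add
over blocks, averaging over i k gives the identity [mean_step]
  V (k+1) = (1 - 1/m) V k + (1/m) E |T (x (k - tau k)) - z|^2.
There is no correlation term to control: the update overwrites a block instead
of incrementing it, so a stale iterate enters only through the convex
combination above.  Hence any bound on the delays will do, and there is no step
size to adapt to it.

For an averaged T, |T y - z|^2 <= |y - z|^2 - b |y - T y|^2 with b > 0
([averaged_descent]), so as long as every residual mean up to time k is at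
least e, the recursion loses (b/m) e per step, up to the delay.  The affine
function V 0 - g t with g = b e / (m + taubar) dominates V: the delayed argument
costs at most g taubar / m, and g (1 + taubar/m) = b e / m.  As V stays
nonnegative, e (k+1) is bounded ([delayed_linear_decay]); take for e the
smallest residual mean.

For a pseudo-contractive T the recursion becomes
V (k+1) <= (1 - 1/m) V k + (c^2/m) V (k - tau k), and rho^k V 0 dominates V as
soon as (1 - 1/m) + (c^2/m) rho^(-taubar) <= rho.  The rate of the theorem
satisfies this inequality thanks to Bernoulli's inequality
([delayed_geometric_decay]).

The probability is elementary: x k is a function of the finitely many values
(i 0, ..., i (k-1)), so every expectation is a finite sum over such histories
([expectation_history], [expectation_next]). *)

(** * Euclidean norm and averaged operators *)

Section EuclideanNorm.
Context {R : realType}.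

Lemma sqr_eucl_norm n (x : 'rV[R]_n) :
  eucl_norm x ^+ 2 = \sum_(l < n) x ord0 l ^+ 2.
Proof. by rewrite sqr_sqrtr// sumr_ge0// => l _; rewrite sqr_ge0. Qed.

Lemma eucl_norm_ge0 n (x : 'rV[R]_n) : 0 <= eucl_norm x.
Proof. exact: sqrtr_ge0. Qed.

Lemma sqr_eucl_normZ n (a : R) (x : 'rV[R]_n) :
  eucl_norm (a *: x) ^+ 2 = a ^+ 2 * eucl_norm x ^+ 2.
Proof.
rewrite !sqr_eucl_norm mulr_sumr; apply: eq_bigr => l _.
by rewrite mxE exprMn.
Qed.

Lemma sqr_eucl_norm_convex n (a : R) (u v : 'rV[R]_n) :
  eucl_norm ((1 - a) *: u + a *: v) ^+ 2 =
  (1 - a) * eucl_norm u ^+ 2 + a * eucl_norm v ^+ 2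
  - a * (1 - a) * eucl_norm (u - v) ^+ 2.
Proof.
rewrite !sqr_eucl_norm !mulr_sumr -big_split -sumrB /=.
by apply: eq_bigr => l _; rewrite !mxE; ring.
Qed.

Lemma sqr_eucl_norm_blocks m (d_ : 'I_m -> nat) (x : 'rV[R]_(\sum_j d_ j)) :
  eucl_norm x ^+ 2 = \sum_j eucl_norm (submxrow x j) ^+ 2.
Proof.
have dotE n (y : 'rV[R]_n) : eucl_norm y ^+ 2 = (y *m y^T) ord0 ord0.
  by rewrite sqr_eucl_norm !mxE; apply: eq_bigr => l _; rewrite mxE expr2.
rewrite dotE -[in LHS](submxrowK x) tr_mxrow mul_mxrow_mxcol summxE.
by apply: eq_bigr => j _; rewrite dotE.
Qed.

(** With T = (1 - a) Id + a N, the point xs is also fixed by N, and the convexity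
identity at u = y - xs, v = N y - xs has the correction term
a (1 - a) |u - v|^2.  Since y - T y = a (u - v), that term is
((1 - a) / a) |y - T y|^2. *)
Lemma averaged_descent n (T : 'rV[R]_n -> 'rV[R]_n) (xs : 'rV[R]_n) :
  Fix T xs -> averaged T ->
  exists2 b : R, 0 < b & forall y,
    eucl_norm (T y - xs) ^+ 2 + b * eucl_norm (y - T y) ^+ 2
    <= eucl_norm (y - xs) ^+ 2.
Proof.
move=> Txs [a [/andP[a0 a1] [N neN TE]]]; exists ((1 - a) / a).
  by rewrite divr_gt0// subr_gt0.
have Nxs : N xs = xs.
  apply: (scalerI (lt0r_neq0 a0)); apply: (addrI ((1 - a) *: xs)).
  by rewrite -TE Txs -scalerDl subrK scale1r.
move=> y; have -> : T y - xs = (1 - a) *: (y - xs) + a *: (N y - xs).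
  by rewrite TE !scalerBr addrACA -opprD -scalerDl subrK scale1r.
have -> : y - T y = a *: ((y - xs) - (N y - xs)).
  by rewrite TE; apply/rowP => l; rewrite !mxE; ring.
rewrite sqr_eucl_norm_convex sqr_eucl_normZ.
have : eucl_norm (N y - xs) ^+ 2 <= eucl_norm (y - xs) ^+ 2.
  by rewrite ler_sqr ?nnegrE ?eucl_norm_ge0// -{1}Nxs neN.
move: (eucl_norm (y - xs) ^+ 2) (eucl_norm (N y - xs) ^+ 2) => u v.
move: (eucl_norm _ ^+ 2) => w uv.
have -> : (1 - a) / a * (a ^+ 2 * w) = a * (1 - a) * w.
  by field; exact: lt0r_neq0.
by nra.
Qed.

End EuclideanNorm.

(** * Scalar recursions with bounded delay *)

Section DelayedRecursions.
Context {R : realType}.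

Lemma bernoulli_le (v : R) n : 0 <= v -> 1 + n%:R * (v - 1) <= v ^+ n.
Proof.
move=> v0; elim: n => [|n IH]; first by rewrite mul0r addr0.
rewrite exprS; apply: (le_trans _ (ler_wpM2l v0 IH)).
rewrite -natr1; have := ler0n R n; move: n%:R => r r0.
have := mulr_ge0 r0 (sqr_ge0 (v - 1)); nra.
Qed.

(** The slope g = b e / (m + taubar) is the largest one for which the affine bound
V 0 - g t reproduces itself: with the worst delay, one step of the recursion
gives at most V 0 - g t + g taubar / m - b e / m, and this is V 0 - g (t + 1). *)
Lemma delayed_linear_decay (V D : nat -> R) (tau : nat -> nat) (taubar m : nat)
    (b e : R) (k : nat) :
  (0 < m)%N -> 0 < b -> 0 <= e ->
  (forall t, (tau t <= t)%N) -> (forall t, (tau t <= taubar)%N) ->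
  0 <= V k.+1 -> (forall t, (t <= k)%N -> e <= D t) ->
  (forall t, V t.+1 <=
     (1 - m%:R^-1) * V t + m%:R^-1 * (V (t - tau t)%N - b * D (t - tau t)%N)) ->
  e * k.+1%:R <= V 0%N * (m%:R + taubar%:R) / b.
Proof.
move=> m0 b0 e0 taut taub Vk eD rec.
have m0' : 0 < m%:R :> R by rewrite ltr0n.
have t0' : 0 <= taubar%:R :> R by [].
set g := b * e / (m%:R + taubar%:R).
have mt0 : 0 < m%:R + taubar%:R :> R by rewrite ltr_pwDl.
have g0 : 0 <= g by apply: divr_ge0; [rewrite mulr_ge0 ?(ltW b0)|exact: ltW].
have gE : g * (m%:R + taubar%:R) = b * e by rewrite divfK// gt_eqF.
have decay t : (t <= k.+1)%N -> V t <= V 0%N - g * t%:R.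
  elim/ltn_ind: t => [[|t]] IH tk; first by rewrite mulr0 subr0.
  apply: (le_trans (rec t)).
  have Vt := IH t (ltnSn _) (ltnW tk).
  have := IH (t - tau t)%N.
  rewrite ltnS leq_subr (leq_trans (leq_subr _ _) (ltnW tk)).
  move=> /(_ isT isT); rewrite natrB// => Vtau.
  have De := eD (t - tau t)%N (leq_trans (leq_subr _ _) (tk : (t <= k)%N)).
  have tb : (tau t)%:R <= taubar%:R :> R by rewrite ler_nat.
  have s0 : 0 <= 1 - m%:R^-1 :> R by rewrite subr_ge0 invf_le1// ler1n.
  have i0 : 0 <= m%:R^-1 :> R by rewrite invr_ge0 ltW.
  have gt_tb : g * (tau t)%:R <= g * taubar%:R by rewrite ler_wpM2l.
  have bDe : b * e <= b * D (t - tau t)%N by rewrite ler_wpM2l// ltW.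
  apply: (@le_trans _ _ ((1 - m%:R^-1) * (V 0%N - g * t%:R)
     + m%:R^-1 * (V 0%N - g * (t%:R - taubar%:R) - b * e))).
    by apply: lerD; rewrite ler_wpM2l//; lra.
  rewrite -gE -natr1.
  by rewrite le_eqVlt; apply/orP; left; apply/eqP; field; rewrite gt_eqF.
have := decay k.+1 (leqnn _).
rewrite ler_pdivlMr// => Vle.
have : g * k.+1%:R <= V 0%N by lra.
move=> /(ler_wpM2r (addr_ge0 (ltW m0') t0')); rewrite mulrAC gE.
lra.
Qed.

(** The induction needs a <= (rho - s) rho^taubar, where s = 1 - 1/m and
a = c^2 / m.  Put u = rho^taubar and v = u^(1/m); the exponent defining rho is
chosen so that rho v = s + a.  The claim is then rho (v - u) <= s (1 - u), which
follows from v - u <= s (1 - u), that is Bernoulli's inequality for v^m = u, and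
from rho <= 1. *)
Lemma delayed_geometric_decay (V : nat -> R) (tau : nat -> nat)
    (taubar m : nat) (c : R) :
  (0 < m)%N -> 0 < c < 1 ->
  (forall t, (tau t <= t)%N) -> (forall t, (tau t <= taubar)%N) ->
  0 <= V 0%N ->
  (forall t, V t.+1 <=
     (1 - m%:R^-1) * V t + m%:R^-1 * (c ^+ 2 * V (t - tau t)%N)) ->
  forall k, V k <=
    ((1 - (1 - c ^+ 2) / m%:R) `^ (1 / (1 + taubar%:R / m%:R))) ^+ k * V 0%N.
Proof.
move=> m0 /andP[c0 c1] taut taub V0 rec.
have m0' : 0 < m%:R :> R by rewrite ltr0n.
set s : R := 1 - m%:R^-1.
have s0 : 0 <= s by rewrite subr_ge0 invf_le1// ler1n.
have i0 : 0 < m%:R^-1 :> R by rewrite invr_gt0.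
set a := c ^+ 2 / m%:R.
have a0 : 0 < a by rewrite divr_gt0// exprn_gt0.
set q := 1 - _; have qE : q = s + a by rewrite /q /s /a; lra.
have q0 : 0 < q by rewrite qE ltr_wpDl.
have q1 : q <= 1.
  by rewrite /q lerBlDr lerDl divr_ge0 ?ltW// subr_gt0 expr_lt1 ?ltW.
set p := 1 + taubar%:R / m%:R.
have p0 : 0 < p by rewrite ltr_wpDr// divr_ge0.
set rho := q `^ (1 / p).
have rho0 : 0 < rho by rewrite powR_gt0.
have rho1 : rho <= 1.
  have p1 : (1 : R) `^ (1 / p) = 1 by rewrite powR1.
  rewrite -[leRHS]p1 ge0_ler_powR// ?nnegrE ?(ltW q0)//.
  by rewrite divr_ge0// ltW.
set v := rho `^ (taubar%:R / m%:R).
have v0 : 0 <= v by exact: powR_ge0.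
have rhov : rho * v = q.
  rewrite -{1}(powRr1 (ltW rho0)) -powRD; last by rewrite (gt_eqF rho0) implybT.
  by rewrite -/p /rho -powRrM mul1r mulVf ?powRr1 ?gt_eqF ?ltW.
have vm : v ^+ m = rho ^+ taubar.
  rewrite -powR_mulrn// /v -powRrM divfK ?gt_eqF//.
  by rewrite powR_mulrn// ltW.
set u := rho ^+ taubar.
have u0 : 0 < u by rewrite exprn_gt0.
have u1 : u <= 1 by rewrite exprn_ile1// ltW.
have vu : v - u <= s * (1 - u).
  have := bernoulli_le m v0; rewrite vm -/u => B.
  have -> : s = (m%:R - 1) / m%:R by rewrite /s mulrBl mulfV ?gt_eqF// mul1r.
  by rewrite -(ler_pM2l m0') mulrA mulrCA mulfV ?gt_eqF//; lra.
have a_le : a <= (rho - s) * u.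
  suff : rho * (v - u) <= s * (1 - u) by move: rhov; rewrite qE; lra.
  have su : 0 <= s * (1 - u) by rewrite mulr_ge0// subr_ge0.
  apply: (le_trans (ler_wpM2l (ltW rho0) vu)); nra.
have rhos : 0 <= rho - s by nra.
elim/ltn_ind => [[|k]] IH; first by rewrite expr0 mul1r.
apply: (le_trans (rec k)); rewrite -/s.
have Vk := IH k (ltnSn _); have Vt := IH (k - tau k)%N (leq_subr _ _).
apply: (@le_trans _ _ (s * (rho ^+ k * V 0%N) + a * (rho ^+ (k - tau k) * V 0%N))).
  apply: lerD; first by rewrite ler_wpM2l.
  by rewrite [m%:R^-1 * _]mulrA [m%:R^-1 * _]mulrC -/a ler_wpM2l// ltW.
rewrite !mulrA -mulrDl ler_wpM2r// exprS.
have : a * rho ^+ (k - tau k) <= (rho - s) * rho ^+ k.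
  apply: (le_trans (ler_wpM2r (exprn_ge0 _ (ltW rho0)) a_le)).
  rewrite -mulrA ler_wpM2l// -exprD ler_wiXn2l ?(ltW rho0)//.
  by have := leq_add (taub k) (leqnn (k - tau k)); rewrite subnKC.
by rewrite mulrBl lerBrDl.
Qed.

End DelayedRecursions.

(** * Expectations of functions of finitely many selections *)

Section FiniteExpectation.
Context d (Omega : measurableType d) (R : realType) (P : probability Omega R).

Lemma expectation_finite (F : finType) (H : Omega -> F) (G : F -> R) :
  (forall a, measurable (H @^-1` [set a])) -> (forall a, 0 <= G a) ->
  ('E_P[fun w => G (H w)] =
   (\sum_a G a * fine (P (H @^-1` [set a])))%:E)%E.
Proof.
move=> mH G0; rewrite unlock.
have -> : (fun w => (G (H w))%:E) =
    (fun w => \sum_a (G a * \1_(H @^-1` [set a]) w)%:E)%E.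
  apply/funext => w; rewrite sumEFin (bigD1 (H w))//= big1 => [|a aH].
    by rewrite indicE mem_set// mulr1 addr0.
  by rewrite indicE memNset ?mulr0// => /= Ha; rewrite Ha eqxx in aH.
rewrite ge0_integral_sum//; first last.
- by move=> a w _; rewrite lee_fin mulr_ge0.
- move=> a; apply/measurable_realfun.measurable_EFinP.
  exact: measurable_realfun.measurable_funM.
rewrite -sumEFin; apply: eq_bigr => a _.
rewrite (integralZl_indic _ (fun=> H @^-1` [set a]))//; last first.
  by rewrite ltNge G0.
by rewrite integral_indic// setIT EFinM fineK// fin_num_measure.
Qed.

End FiniteExpectation.

Section History.
Context d (Omega : measurableType d) (R : realType) (P : probability Omega R).
Context (m : nat) (i : nat -> Omega -> 'I_m).

Definition history k (w : Omega) : {ffun 'I_k -> 'I_m} := [ffun l : 'I_k => i l w].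

(** The sets [A] are indexed by all of nat, although only the first k matter, to
match the shape of the independence hypothesis; their values from k on can then
be chosen to describe the next selection as well. *)
Lemma history_fiber k (a : {ffun 'I_k -> 'I_m}) (A : nat -> set 'I_m) :
  (forall l : 'I_k, A l = [set a l]) ->
  history k @^-1` [set a] =
  \bigcap_(l in [set` [fset l in iota 0 k]%fset]) (i l @^-1` A l).
Proof.
move=> hA; apply/seteqP; split=> w /=.
  move=> ha l /=; rewrite !inE mem_iota /= add0n => lk.
  by rewrite (hA (Ordinal lk)) /= -ha ffunE.
move=> ha; apply/ffunP => l; rewrite ffunE.
have := ha l; rewrite hA /= !inE mem_iota /= add0n; apply; exact: ltn_ord.
Qed.

Context (hmeas : forall k, block_rv (i k)).

Lemma measurable_history k a : measurable (history k @^-1` [set a]).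
Proof.
pose A l := if insub l is Some u then [set a u] else setT : set 'I_m.
rewrite (@history_fiber k a A); last by move=> l; rewrite /A valK.
apply: fin_bigcap_measurable => [|l _]; first exact: finite_fset.
exact: hmeas.
Qed.

Context (hindep : mutually_independent P i)
  (hunif : forall k, uniform_block P (i k)).

Lemma history_next_prob k (a : {ffun 'I_k -> 'I_m}) (j : 'I_m) :
  (P (history k @^-1` [set a] `&` i k @^-1` [set j]) =
   P (history k @^-1` [set a]) * (m%:R^-1)%:E)%E.
Proof.
pose A l := if insub l is Some u then [set a u] else [set j] : set 'I_m.
have hA (l : 'I_k) : A l = [set a l] by rewrite /A valK.
have Ak : A k = [set j] by rewrite /A insubN// ltnn.
rewrite (history_fiber hA) setIC -{1}Ak.
have -> : i k @^-1` A k `&`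
    \bigcap_(l in [set` [fset l in iota 0 k]%fset]) (i l @^-1` A l) =
    \bigcap_(l in [set` (k |` [fset l in iota 0 k])%fset]) (i l @^-1` A l).
  by rewrite set_fsetU1 bigcap_setU1.
rewrite !hindep big_fsetU1/=; last by rewrite !inE mem_iota add0n ltnn andbF.
by rewrite muleC Ak hunif.
Qed.

Lemma expectation_history k (G : {ffun 'I_k -> 'I_m} -> R) :
  (forall a, 0 <= G a) ->
  ('E_P[fun w => G (history k w)] =
   (\sum_a G a * fine (P (history k @^-1` [set a])))%:E)%E.
Proof.
by move=> G0; apply: (@expectation_finite _ _ _ P _ (history k)) => // a;
  exact: measurable_history.
Qed.

(** This replaces conditioning on the past: integrating out the next selection
turns it into an average over the m blocks. *)
Lemma expectation_next k (G : {ffun 'I_k -> 'I_m} -> 'I_m -> R) :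
  (forall a j, 0 <= G a j) ->
  ('E_P[fun w => G (history k w) (i k w)] =
   (\sum_a (m%:R^-1 * \sum_j G a j) *
      fine (P (history k @^-1` [set a])))%:E)%E.
Proof.
move=> G0; pose H w := (history k w, i k w).
have HE a j : H @^-1` [set (a, j)] =
    history k @^-1` [set a] `&` i k @^-1` [set j].
  by rewrite /H; apply/seteqP; split=> [w /= [-> ->]|w /= [-> ->]].
have mH aj : measurable (H @^-1` [set aj]).
  case: aj => a j; rewrite HE; apply: measurableI; last exact: hmeas.
  exact: measurable_history.
apply: eq_trans.
  exact: (@expectation_finite _ _ _ P _ H (fun aj => G aj.1 aj.2)).
congr (_%:E); transitivity (\sum_aj G aj.1 aj.2 *
    fine (P (H @^-1` [set (aj.1, aj.2)]))); first by apply: eq_bigr => -[].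
rewrite -(pair_bigA _ (fun a j => G a j * fine (P (H @^-1` [set (a, j)])))) /=.
apply: eq_bigr => a _; rewrite mulr_sumr mulr_suml; apply: eq_bigr => j _.
rewrite HE history_next_prob fineM ?fin_num_measure//; last first.
  exact: measurable_history.
by rewrite /=; ring.
Qed.

End History.

(** * The iterates of DEGAS *)

Section Degas.
Context (R : realType) (m : nat) (hm : (0 < m)%N) (d_ : 'I_m -> nat).
Notation vec := 'rV[R]_(\sum_j d_ j).
Context (T : vec -> vec) d (Omega : measurableType d) (P : probability Omega R).
Context (i : nat -> Omega -> 'I_m) (hmeas : forall k, block_rv (i k)).
Context (hindep : mutually_independent P i).
Context (hunif : forall k, uniform_block P (i k)).
Context (tau : nat -> nat) (x0 : vec) (x : nat -> Omega -> vec).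
Context (hx : degas T tau i x0 x).

Lemma degas_adapted k w w' :
  (forall l, (l < k)%N -> i l w = i l w') -> x k w = x k w'.
Proof.
have [_ x0E xS] := hx.
elim/ltn_ind: k => [[|k]] IH iE; first by rewrite !x0E.
have E l : (l <= k)%N -> x l w = x l w'.
  by move=> lk; apply: IH => // l' l'l; apply/iE/(leq_trans l'l)/leqW.
apply/mxrowP => j.
by rewrite !xS iE// !E// leq_subr.
Qed.

(** Adaptedness gives Y by choice; on histories that do not occur, Y is given the
dummy value x0. *)
Lemma degas_of_history k : exists Y : nat -> {ffun 'I_k -> 'I_m} -> vec,
  forall l w, (l <= k)%N -> x l w = Y l (history i k w).
Proof.
pose Y l a := if pselect (exists w, history i k w = a) is left h
  then x l (projT1 (cid h)) else x0.
exists Y => l w lk; rewrite /Y; case: pselect => [h|]; last by case; exists w.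
case: cid => w' /= /ffunP hw; apply: degas_adapted => l' l'l.
by have := hw (Ordinal (leq_trans l'l lk)); rewrite !ffunE.
Qed.

(** The functions f of interest are nonnegative; for these the expectation is
finite ([meanE]), so that taking its real value loses nothing. *)
Definition mean (f : vec -> R) k : R := fine ('E_P[fun w => f (x k w)])%E.

Lemma expectation_degas k (Y : nat -> {ffun 'I_k -> 'I_m} -> vec) f l :
  (forall l w, (l <= k)%N -> x l w = Y l (history i k w)) ->
  (forall y, 0 <= f y) -> (l <= k)%N ->
  ('E_P[fun w => f (x l w)] =
   (\sum_a f (Y l a) * fine (P (history i k @^-1` [set a])))%:E)%E.
Proof.
move=> YE f0 lk; rewrite -(expectation_history P hmeas (fun a => f0 _)).
by congr expectation; apply/funext => w; rewrite YE.
Qed.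

Lemma meanE f k : (forall y, 0 <= f y) ->
  ('E_P[fun w => f (x k w)] = (mean f k)%:E)%E.
Proof.
move=> f0; have [Y YE] := degas_of_history k.
by rewrite /mean (expectation_degas YE).
Qed.

Lemma mean_ge0 f k : (forall y, 0 <= f y) -> 0 <= mean f k.
Proof.
move=> f0; rewrite /mean; apply: fine_ge0; rewrite unlock.
by apply: integral_ge0 => w _; rewrite lee_fin.
Qed.

Lemma mean0 f : (forall y, 0 <= f y) -> mean f 0 = f x0.
Proof.
have [_ x0E _] := hx => f0; rewrite /mean.
rewrite (_ : (fun w => _) = cst (f x0)) ?expectation_cst//.
by apply/funext => w /=; rewrite x0E.
Qed.

Lemma mean_le f g h (b c : R) k :
  (forall y, 0 <= f y) -> (forall y, 0 <= g y) -> (forall y, 0 <= h y) ->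
  (forall y, f y + b * g y <= c * h y) ->
  mean f k + b * mean g k <= c * mean h k.
Proof.
move=> f0 g0 h0 fgh; have [Y YE] := degas_of_history k.
rewrite /mean !(expectation_degas YE)//= !mulr_sumr -big_split/=.
by apply: ler_sum => a _; rewrite !mulrA -mulrDl ler_wpM2r ?fine_ge0.
Qed.

(** When block j is selected, the block l of x k.+1 - z is that of
T (x (k - tau k)) - z if l = j, and that of x k - z otherwise.  Summing the
squared norms over j as well, each block of the former is counted once and each
block of the latter m - 1 times. *)
Lemma mean_step (z : vec) k :
  mean (fun y => eucl_norm (y - z) ^+ 2) k.+1 =
  (1 - m%:R^-1) * mean (fun y => eucl_norm (y - z) ^+ 2) k +
  m%:R^-1 * mean (fun y => eucl_norm (T y - z) ^+ 2) (k - tau k).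
Proof.
have [_ _ xS] := hx.
have [Y YE] := degas_of_history k.
pose p a := fine (P (history i k @^-1` [set a])).
have E f l : (forall y, 0 <= f y) -> (l <= k)%N ->
    mean f l = \sum_a f (Y l a) * p a.
  by move=> f0 lk; rewrite /mean (expectation_degas YE).
rewrite (E _ k)//; last by move=> y; rewrite sqr_ge0.
rewrite (E _ (k - tau k)%N) ?leq_subr//; last by move=> y; rewrite sqr_ge0.
pose G a j := \sum_l eucl_norm (submxrow (if l == j then
  T (Y (k - tau k)%N a) - z else Y k a - z) l) ^+ 2.
have G0 a j : 0 <= G a j by apply: sumr_ge0 => l _; rewrite sqr_ge0.
rewrite /mean (_ : (fun w => _) = (fun w => G (history i k w) (i k w))).
  rewrite (expectation_next hmeas hindep hunif)//= !mulr_sumr -big_split/=.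
  apply: eq_bigr => a _; rewrite -/(p a).
  rewrite [_ * (_ * p a)]mulrA [_ * (_ * p a)]mulrA -mulrDl; congr (_ * _).
  rewrite /G exchange_big/=.
  under eq_bigr => l _.
    rewrite (bigD1 l)//= eqxx.
    rewrite (eq_bigr (fun=> eucl_norm (submxrow (Y k a - z) l) ^+ 2)); last first.
      by move=> j; rewrite eq_sym => /negbTE ->.
    rewrite sumr_const cardC1 card_ord.
    over.
  rewrite big_split/= sumrMnl -!sqr_eucl_norm_blocks mulrDr addrC; congr (_ + _).
  rewrite -[_ *+ m.-1]mulr_natl mulrA; congr (_ * _).
  by rewrite -subn1 natrB// mulrBr mulVf ?mulr1// pnatr_eq0 -lt0n.
apply/funext => w; rewrite sqr_eucl_norm_blocks; apply: eq_bigr => l _.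
rewrite -(YE k w (leqnn k)) -(YE _ w (leq_subr (tau k) k)) !submxrowB xS.
by case: eqP => _; rewrite submxrowB.
Qed.

End Degas.

Theorem theorem1 (R : realType) (m : nat) (hm : (0 < m)%N) (d_ : 'I_m -> nat)
    (T : 'rV[R]_(\sum_j d_ j) -> 'rV[R]_(\sum_j d_ j))
    (xs : 'rV[R]_(\sum_j d_ j)) (hxs : Fix T xs)
    (disp : measure_display) (Omega : measurableType disp)
    (P : probability Omega R)
    (i : nat -> Omega -> 'I_m)
    (hmeas : forall k, block_rv (i k))
    (hindep : mutually_independent P i)
    (hunif : forall k, uniform_block P (i k))
    (tau : nat -> nat) (taubar : nat) (htau : forall k, (tau k <= taubar)%N)
    (x0 : 'rV[R]_(\sum_j d_ j))
    (x : nat -> Omega -> 'rV[R]_(\sum_j d_ j))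
    (hx : degas T tau i x0 x)
    (hT : averaged T) :
  (exists C : R, \forall k \near \oo,
     (\big[mine/+oo]_(t < k.+1)
        'E_P[fun w => (eucl_norm (x t w - T (x t w)) ^+ 2)%R]
      <= (C * k%:R^-1)%R%:E)%E) /\
  (forall c : R, pseudo_contractive c T ->
   forall k : nat,
     ('E_P[fun w => (eucl_norm (x k w - xs) ^+ 2)%R] <=
      ((((1 - (1 - c ^+ 2) / m%:R) `^ (1 / (1 + taubar%:R / m%:R))) ^+ k
        * eucl_norm (x0 - xs) ^+ 2)%R)%:E)%E).
Proof.
have [taut _ _] := hx.
pose dist (y : 'rV[R]_(\sum_j d_ j)) : R := eucl_norm (y - xs) ^+ 2.
pose distT (y : 'rV[R]_(\sum_j d_ j)) : R := eucl_norm (T y - xs) ^+ 2.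
pose res (y : 'rV[R]_(\sum_j d_ j)) : R := eucl_norm (y - T y) ^+ 2.
have dist0 y : 0 <= dist y by rewrite sqr_ge0.
have distT0 y : 0 <= distT y by rewrite sqr_ge0.
have res0 y : 0 <= res y by rewrite sqr_ge0.
pose E f k := mean P x f k.
have EE (f : _ -> R) k : (forall y, 0 <= f y) ->
    ('E_P[fun w => f (x k w)] = (E f k)%:E)%E.
  exact: (meanE P hmeas hx).
have E0 f k : (forall y, 0 <= f y) -> 0 <= E f k by exact: mean_ge0.
have step k : E dist k.+1 = (1 - m%:R^-1) * E dist k
    + m%:R^-1 * E distT (k - tau k)%N.
  exact: (mean_step hm hmeas hindep hunif hx).
have Edist0 : E dist 0%N = dist x0 by exact: (mean0 P hx).
have i0 : 0 <= m%:R^-1 :> R by rewrite invr_ge0.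
split.
  have [b b0 descent] := averaged_descent hxs hT.
  exists (dist x0 * (m%:R + taubar%:R) / b); near=> k.
  have k0 : (0 < k)%N by near: k; exact: nbhs_infty_gt.
  (* The minimum is attained at a time t0, whose residual mean bounds all the
     others from below and serves as e in the linear decay. *)
  pose t0 := [arg min_(t < ord0 : 'I_k.+1) E res t]%O.
  have t0min (t : 'I_k.+1) : E res t0 <= E res t.
    by rewrite /t0; case: Order.TotalTheory.arg_minP => // s _; apply.
  rewrite (bigD1 t0)//=; apply: (@le_trans _ _ (E res t0)%:E).
    by rewrite (EE res)// ge_min lexx.
  rewrite lee_fin.
  have := @delayed_linear_decay R (E dist) (E res) tau taubar m b (E res t0) k.
  rewrite Edist0 => /(_ hm b0 (E0 _ _ res0) taut htau).
  move=> /(_ (E0 _ _ dist0)) H.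
  rewrite ler_pdivlMr ?ltr0n//; apply: le_trans (H _ _).
  - by rewrite ler_wpM2l ?E0// ler_nat.
  - by move=> t tk; exact: (t0min (Ordinal (tk : (t < k.+1)%N))).
  - move=> t; rewrite step lerD2l ler_wpM2l// lerBrDr -[leRHS]mul1r.
    by apply: (mean_le P hmeas hx) => // y; rewrite mul1r; exact: descent.
move=> c [/andP[c0 c1] _ contr] k; rewrite (EE dist)// lee_fin.
rewrite -/(dist x0) -Edist0.
apply: (delayed_geometric_decay (tau := tau)) => //.
- by rewrite c0.
- exact: E0.
move=> t; rewrite step lerD2l ler_wpM2l//.
rewrite -[leLHS]addr0 -(mul0r (E dist (t - tau t)%N)).
apply: (mean_le P hmeas hx) => // y; rewrite mul0r addr0 /distT /dist -exprMn.
rewrite ler_sqr ?nnegrE ?mulr_ge0 ?eucl_norm_ge0 ?(ltW c0)//.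
by rewrite -{1}hxs contr.
Unshelve. all: by end_near.
Qed.
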